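(* Let $n\ge 1$, let $a=(a_1,\ldots,a_n)$ and $b=(b_1,\ldots,b_n)$ be two $n$-tuples of positive integers, and let $X\subseteq\mathbb{N}$. The graph $\mathrm{G}(\mathcal{N}(a,b,X))$ is a tree with root $\mathbb{N}$. Moreover, the set of children of a vertex $S\in\mathcal{N}(a,b,X)$ is $$\left\{ S\setminus\{m\} \mid m\in\mathrm{msg}(S),\; m>\mathrm{F}(S),\; \text{and}\; S\setminus\{m\}\in\mathcal{N}(a,b,X)\right\}.$$
   Context: $\mathbb{N}$ is the set of non-negative integers. A numerical semigroup is a submonoid $S$ of $(\mathbb{N},+)$ with $\mathbb{N}\setminus S$ finite; its Frobenius number $\mathrm{F}(S)$ is the maximum integer not belonging to $S$ (so $\mathrm{F}(\mathbb{N})=-1$). $\mathrm{msg}(S)$ denotes the (unique) minimal system of generators of $S$, i.e. $\mathrm{msg}(S)=(S\setminus\{0\})\setminus\big((S\setminus\{0\})+(S\setminus\{0\})\big)$. For $s\in\mathbb{N}$, $as+b=(a_1s+b_1,\ldots,a_ns+b_n)$. $\mathcal{N}(a,b,X)$ is the set of all numerical semigroups $S$ such that $X\subseteq S$ and $as+b\in S^n$ for all $s\in S\setminus\{0\}$. A graph is a pair $(V,E)$ with $V$ a non-empty set (of vertices) and $E\subseteq\{(v,w)\in V\times V\mid v\neq w\}$ (edges). A path of length $k$ connecting vertices $x$ and $y$ is a sequence of different edges $(v_0,v_1),(v_1,v_2),\ldots,(v_{k-1},v_k)$ with $v_0=x$ and $v_k=y$. A graph is a tree if there is a vertex $r$ (the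 root) such that for every other vertex $x$ there exists a unique path connecting $x$ and $r$. If $(x,y)$ is an edge of a tree, then $x$ is a child of $y$. The graph $\mathrm{G}(\mathcal{N}(a,b,X))$ has vertex set $\mathcal{N}(a,b,X)$, and $(S,S')\in\mathcal{N}(a,b,X)\times\mathcal{N}(a,b,X)$ is an edge if and only if $S'=S\cup\{\mathrm{F}(S)\}$. *)

(* Defs.v *)
From mathcomp Require Import all_boot all_order all_algebra.
From mathcomp Require Import boolp classical_sets cardinality.

Set Implicit Arguments.
Unset Strict Implicit.
Unset Printing Implicit Defensive.

Import Order.TTheory GRing.Theory Num.Theory.

Local Open Scope classical_set_scope.

Section Graphs.
Variable T : choiceType.

Definition is_graph (V : set T) (E : set (T * T)) : Prop :=
  V !=set0 /\ E `<=` [set e | [/\ V e.1, V e.2 & e.1 <> e.2]].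

(* A path is its sequence of edges, so that its length is [size p]. *)
Fixpoint is_walk (E : set (T * T)) (x : T) (p : seq (T * T)) (y : T) : Prop :=
  if p is e :: p' then [/\ E e, e.1 = x & is_walk E e.2 p' y] else x = y.

Definition is_path (E : set (T * T)) (x : T) (p : seq (T * T)) (y : T) : Prop :=
  is_walk E x p y /\ uniq p.

Definition is_tree_with_root (V : set T) (E : set (T * T)) (r : T) : Prop :=
  [/\ is_graph V E, V r
    & forall x, V x -> x <> r -> exists! p, is_path E x p r].

Definition children (E : set (T * T)) (y : T) : set T := [set x | E (x, y)].

End Graphs.

Definition numerical_semigroup (S : set nat) : Prop :=
  [/\ S 0, forall x y, S x -> S y -> S (x + y) & finite_set (~` S)].

Definition int_image (S : set nat) : set int := [set x%:Z | x in S]%R.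

(* The maximum is over all integers, so that negative integers, which never
   belong to [S], are candidates: this gives -1 for [S = setT]. The default
   value 0 is used only when the maximum does not exist, which does not happen
   for a numerical semigroup. *)
Definition frobenius (S : set nat) : int :=
  xget 0%R [set f : int | ~ int_image S f /\
                          forall z : int, ~ int_image S z -> (z <= f)%R].

Definition msg (S : set nat) : set nat :=
  (S `\ 0) `\` [set x + y | x in S `\ 0 & y in S `\ 0].

Definition affine n (a b : n.-tuple nat) (s : nat) : n.-tuple nat :=
  [tuple tnth a i * s + tnth b i | i < n].

Definition NabX n (a b : n.-tuple nat) (X : set nat) : set (set nat) :=
  [set S | [/\ numerical_semigroup S, X `<=` S
             & forall s, (S `\ 0) s -> forall i, S (tnth (affine a b s) i)]].

(* The equality [S' = S `|` [set F(S)]] is between sets of integers, since the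
   Frobenius number may be -1; in particular no edge leaves [setT]. *)
Definition GNabX n (a b : n.-tuple nat) (X : set nat) :
    set (set nat * set nat) :=
  [set e | [/\ NabX a b X e.1, NabX a b X e.2
             & int_image e.2 = int_image e.1 `|` [set frobenius e.1]]].

(* Main.v *)
Require Import Defs.
From mathcomp Require Import all_boot all_order all_algebra.
From mathcomp Require Import boolp classical_sets cardinality.
From mathcomp Require Import zify.

Set Implicit Arguments.
Unset Strict Implicit.

Local Open Scope classical_set_scope.

(* Adjoining F(S) to S <> N stays inside N(a,b,X) because a_i F(S) + b_i exceeds
   F(S).  Every vertex has at most one outgoing edge, N has none, and iterating
   S |-> S `|` {F(S)} reaches N since the set of gaps is finite; the path so
   obtained repeats no edge because the vertices along it strictly increase. *)

(** The property that [frobenius] selects through [xget], named so that maximality can be used apart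
    from the choice. *)
Definition is_frobenius (S : set nat) (f : int) : Prop :=
  ~ int_image S f /\ forall z : int, ~ int_image S z -> (z <= f)%R.

Lemma int_imageP (S : set nat) (k : nat) : int_image S k%:Z%R <-> S k.
Proof. by split=> [[j Sj [<-]] | Sk] //; exists k. Qed.

Lemma int_image_lt0 (S : set nat) (z : int) : (z < 0)%R -> ~ int_image S z.
Proof. by move=> z0 [k _ kz]; lia. Qed.

Lemma is_frobenius_unique (S : set nat) (f g : int) :
  is_frobenius S f -> is_frobenius S g -> f = g.
Proof. by move=> [Sf leSf] [Sg leSg]; have := leSf _ Sg; have := leSg _ Sf; lia. Qed.

Lemma is_frobenius_nat (S : set nat) (m : nat) :
  ~ S m -> (forall k, m < k -> S k) -> is_frobenius S m%:Z%R.
Proof.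
move=> Sm gtm; split; first by move/int_imageP.
case=> k Sk; last by lia.
have [mk|km] := ltnP m k; last by lia.
by case: Sk; apply/int_imageP/gtm.
Qed.

Lemma frobenius_eq (S : set nat) (f : int) :
  is_frobenius S f -> frobenius S = f.
Proof.
move=> Sf; apply: (@is_frobenius_unique S) => //.
exact: (@xgetPex _ 0%R (is_frobenius S)) (ex_intro _ f Sf).
Qed.

Lemma cofinite_conductor (S : set nat) :
  finite_set (~` S) -> exists N, forall k, N <= k -> S k.
Proof.
move=> /finite_seqP[s sE]; exists (\max_(i <- s) i).+1 => k sk.
apply: contrapT => Sk; have ks : [set` s] k by rewrite -sE.
by have := @leq_bigmax_seq _ s xpredT id k ks isT; lia.
Qed.

(** Descent on the bound: either [N] is in [S] and the bound drops, or [N] is the largest gap. *)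
Lemma is_frobenius_exists (S : set nat) (N : nat) :
  (forall k, N <= k -> S k) -> exists f, is_frobenius S f.
Proof.
elim: N => [|N IHN] SN.
  (* Bound 0 forces [S] to be all of [nat], whose largest missing integer is -1. *)
  exists (-1)%R; split; first exact: int_image_lt0.
  by case=> k Sk; [case: Sk; apply/int_imageP/SN | lia].
have [SNN|SNN] := pselect (S N); last by exists N%:Z%R; exact: is_frobenius_nat.
apply: IHN => k; rewrite leq_eqVlt => /predU1P[<- //|]; exact: SN.
Qed.

Lemma frobeniusP (S : set nat) :
  finite_set (~` S) -> is_frobenius S (frobenius S).
Proof.
by move=> /cofinite_conductor[N /is_frobenius_exists[f Sf]]; rewrite (frobenius_eq Sf).
Qed.

Lemma frobeniusT : frobenius [set: nat] = (-1)%R.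
Proof.
apply: frobenius_eq; split; first exact: int_image_lt0.
by case=> k Sk; [case: Sk; apply/int_imageP | lia].
Qed.

Lemma int_image_inj (S T : set nat) : int_image S = int_image T -> S = T.
Proof.
by move=> ST; apply/seteqP; split=> k /int_imageP; rewrite (ST, =^~ ST) => /int_imageP.
Qed.

Lemma int_imageU1 (S : set nat) (m : nat) :
  int_image (S `|` [set m]) = int_image S `|` [set m%:Z]%R.
Proof. by rewrite /int_image image_setU image_set1. Qed.

Section Tree.
Variables (n : nat) (a b : n.-tuple nat) (X : set nat).
Hypotheses (ha : forall i, 0 < tnth a i) (hb : forall i, 0 < tnth b i).

(** The number F(S) lies in [int_image T], so it is not -1, and the edge equation between sets of
    integers can be read in [nat]. *)
Lemma edge_notin (S T : set nat) : GNabX a b X (S, T) ->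
  exists2 m : nat, frobenius S = m%:Z%R & ~ S m /\ T = S `|` [set m].
Proof.
move=> [/= [[_ _ finS] _ _] _ TE].
have [Sf _] := frobeniusP finS.
have [m _ mE] : int_image T (frobenius S) by rewrite TE; right.
exists m; rewrite -?mE //; split; first by move=> Sm; apply: Sf; rewrite -mE; exists m.
by apply: int_image_inj; rewrite TE int_imageU1 -mE.
Qed.

Lemma edge_functional (S T U : set nat) :
  GNabX a b X (S, T) -> GNabX a b X (S, U) -> T = U.
Proof.
by move=> [/= _ _ TE] [/= _ _ UE]; apply: int_image_inj; rewrite TE UE.
Qed.

Lemma edge_setT (T : set nat) : ~ GNabX a b X ([set: nat], T).
Proof. by case/edge_notin => m; rewrite frobeniusT. Qed.

Lemma NabX_setT : NabX a b X [set: nat].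
Proof. by split => //; split => //; rewrite setCT; exact: finite_set0. Qed.

Lemma NabX_setU_gap (S : set nat) (m : nat) :
  NabX a b X S -> (forall k, m < k -> S k) -> NabX a b X (S `|` [set m]).
Proof.
move=> [[S0 SD finS] XS Sab] gtm.
(* A sum involving [m] either equals [m] or exceeds it, and everything above [m] is in [S]. *)
have SmD x : (S `|` [set m]) (x + m).
  by case: x => [|x]; [right | left; apply: gtm; lia].
split; first split.
- by left.
- move=> x y [Sx|->] [Sy|->]; [left; exact: SD| exact: SmD | | exact: SmD].
  by rewrite addnC; exact: SmD.
- by apply: sub_finite_set finS; apply: subsetC; exact: subsetUl.
- by move=> x /XS; left.
- move=> s [[Ss|->] s0] i; left; first exact: Sab.
  by rewrite tnth_mktuple; apply: gtm; have := ha i; have := hb i; nia.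
Qed.

(** Induction on a bound [N] beyond the gaps: if the number just below it is missing, it is F(S),
    and adjoining it gives the first edge and a smaller bound. *)
Lemma NabX_walk (S : set nat) (N : nat) :
  NabX a b X S -> (forall k, N <= k -> S k) ->
  exists p, is_walk (GNabX a b X) S p [set: nat].
Proof.
elim: N S => [|N IHN] S VS SN; first by exists [::]; apply/seteqP; split=> // k _; exact: SN.
have [SNN|SNN] := pselect (S N).
  by apply: IHN => // k; rewrite leq_eqVlt => /predU1P[<- //|]; exact: SN.
have VS' := NabX_setU_gap VS SN.
have [|p Sp] := IHN _ VS'.
  by move=> k; rewrite leq_eqVlt => /predU1P[<-|/SN]; [right | left].
exists ((S, S `|` [set N]) :: p); split=> //; split=> //=.
by rewrite int_imageU1 (frobenius_eq (is_frobenius_nat SNN SN)).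
Qed.

(** Each next edge is forced, and neither walk can continue past [setT], so both stop together. *)
Lemma walk_setT_unique (S : set nat) p q :
  is_walk (GNabX a b X) S p [set: nat] -> is_walk (GNabX a b X) S q [set: nat] ->
  p = q.
Proof.
elim: p q S => [|[S1 T] p IHp] [|[S2 U] q] S //=.
- by move=> -> [ST SE _]; rewrite SE in ST; case: (edge_setT ST).
- by move=> [ST SS _] SE; rewrite SS SE in ST; case: (edge_setT ST).
- move=> [ST SE Tp] [SU SE' Uq]; subst S1 S2; have TU := edge_functional ST SU.
  by subst U; rewrite (IHp _ _ Tp Uq).
Qed.

Lemma walk_subset (S T : set nat) p e :
  is_walk (GNabX a b X) S p T -> e \in p -> S `<=` e.1.
Proof.
elim: p S => [|[S1 U] p IHp] S //= [/edge_notin[m _ [_ UE]] <- Up].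
rewrite inE => /predU1P[-> //|/(IHp _ Up)].
by apply: subset_trans; rewrite UE; exact: subsetUl.
Qed.

Lemma walk_uniq (S T : set nat) p : is_walk (GNabX a b X) S p T -> uniq p.
Proof.
elim: p S => [|[S1 U] p IHp] S //= [/edge_notin[m _ [Sm UE]] _ Up].
(* If the first edge recurred later, its target [U] would be contained in its source [S], but [U]
   contains the gap [m] of [S]. *)
rewrite (IHp _ Up) andbT; apply/negP => /(walk_subset Up) /= US.
by apply: Sm; apply: US; rewrite UE; right.
Qed.

Lemma GNabX_tree : is_tree_with_root (NabX a b X) (GNabX a b X) [set: nat].
Proof.
split; [split | exact: NabX_setT | ].
- by exists [set: nat]; exact: NabX_setT.
- move=> [S T] ST; have [VS VT _] := ST; split=> //= SE.
  by have [m _ [Sm TE]] := edge_notin ST; apply: Sm; rewrite SE TE; right.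
- move=> S VS _; have [[_ _ /cofinite_conductor[N SN]] _ _] := VS.
  have [p Sp] := NabX_walk VS SN.
  exists p; split; first by split=> //; exact: walk_uniq Sp.
  by move=> q [Sq _]; exact: walk_setT_unique Sp Sq.
Qed.

Lemma childrenE (S : set nat) : NabX a b X S ->
  children (GNabX a b X) S =
  [set S `\ m | m in [set m | [/\ msg S m, (frobenius S < m%:Z)%R
                                 & NabX a b X (S `\ m)]]].
Proof.
move=> VS; have [[S0 _ finS] _ _] := VS; have [nSF leSF] := frobeniusP finS.
apply/seteqP; split=> T.
- move=> TS; have [m Fm [Tm SE]] := edge_notin TS.
  have [/= VT _ _] := TS; have [[T0 TD finT] _ _] := VT.
  have [_ leTF] := frobeniusP finT.
  have SmT : S `\ m = T.
    by rewrite SE setUDK // => k [-> /Tm].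
  have Sm : S m by rewrite SE; right.
  exists m; rewrite /= ?SmT //; split=> //.
    have m0 : m <> 0 by move=> m0; apply: Tm; rewrite m0.
    (* Nonzero summands of [m] differ from [m], so they lie in [T], and closure of [T] would put [m]
       in [T]. *)
    split=> // -[x [Sx x0] [y [Sy y0] xym]]; apply: Tm; rewrite -xym.
    by apply: TD; rewrite -SmT; split=> //=; simpl in *; lia.
  (* Since [T] is contained in [S], F(S) is missing from [T], so F(S) is at most F(T) = [m];
     equality fails because [m] is in [S]. *)
  have : frobenius S <> m%:Z%R by move=> FE; apply: nSF; rewrite FE; apply/int_imageP.
  have : (frobenius S <= m%:Z)%R.
    by rewrite -Fm; apply: leTF => -[k Tk kF]; apply: nSF; exists k => //; rewrite SE; left.
  by lia.
- case=> m [[[Sm m0] _] Fm VSm] <-; split=> //=.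
  (* As [m] exceeds F(S), removing it makes it the largest gap, and adjoining it again restores
     [S]. *)
  suff -> : frobenius (S `\ m) = m%:Z%R.
    by rewrite -int_imageU1 setUC setD1K.
  apply: frobenius_eq; apply: is_frobenius_nat => [[_ /(_ erefl)] //|k mk].
  split; last by move=> /= km; lia.
  apply: contrapT => Sk; have /leSF : ~ int_image S k%:Z%R by move/int_imageP.
  by lia.
Qed.

End Tree.

Theorem theorem3p1 (n : nat) (hn : 0 < n) (a b : n.-tuple nat)
    (ha : forall i, 0 < tnth a i) (hb : forall i, 0 < tnth b i)
    (X : set nat) :
  is_tree_with_root (NabX a b X) (GNabX a b X) [set: nat] /\
  forall S : set nat, NabX a b X S ->
    children (GNabX a b X) S =
    [set S `\ m | m in [set m | [/\ msg S m, (frobenius S < m%:Z)%R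
                                   & NabX a b X (S `\ m)]]].
Proof. by split; [exact: GNabX_tree | exact: childrenE]. Qed.
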